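(* Let $\kappa$ be an uncountable cardinal, let $n\geq 1$ be a natural number, let $K=B(\kappa)^n$ and let $x=(x_1,\ldots,x_n)\in K$. Let $r=|\{i : \|x_i\|<1\}|$. Then $\mathbb{O}_x(K)\cong [0,1]^r$, where $[0,1]^r$ carries the pointwise order ($(t_1,\ldots,t_r)\leq(s_1,\ldots,s_r)$ iff $t_i\leq s_i$ for every $i$).
   Context: All compact spaces are Hausdorff. $B(\kappa)=\{x\in\ell_2(\kappa):\|x\|_2\leq 1\}$ is the unit ball of the Hilbert space $\ell_2(\kappa)$ with the weak topology; $\|\cdot\|$ is the Hilbert norm. Fiber orders: for a continuous map $f:K\to L$ and $x\in L$, the fiber $\mathbb{F}_x(f)=f^{-1}(x)$ is preordered by: $s\leq t$ iff for every neighborhood $U$ of $s$ there is a neighborhood $V$ of $t$ with $f(V)\subset f(U)$. $\mathbb{O}_x(f)=\mathbb{F}_x(f)/\sim$ is the associated ordered set, where $s\sim t$ iff $s\leq t$ and $t\leq s$. For a compact space $K$ of uncountable weight, $\mathcal{Q}_\omega(K)$ is the set of all Hausdorff quotient spaces $L$ of $K$ of countable weight, with canonical projections $p_L:K\to L$ (a quotient is identified with its equivalence relation on $K$), ordered by: $L\leq L'$ iff there is a continuous surjection $q:L'\to L$ (called the natural projection) with $q\,p_{L'}=p_L$. Countable subsets of $\mathcal{Q}_\omega(K)$ have suprema in $\mathcal{Q}_\omega(K)$ (the supremum corresponds to the intersection of the equivalence relations). A set $\mathcal{S}\subset\mathcal{Q}_\omega(K)$ is cofinal if every $L\in\mathcal{Q}_\omega(K)$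 satisfies $L\leq L'$ for some $L'\in\mathcal{S}$; it is a $\sigma$-semilattice if the supremum of every countable subset of $\mathcal{S}$ belongs to $\mathcal{S}$. For $x\in K$ and an ordered set $O$, ''$\mathbb{O}_x(K)\cong O$'' means: there is a cofinal $\sigma$-semilattice $\mathcal{S}\subset\mathcal{Q}_\omega(K)$ such that for all $L<L'$ in $\mathcal{S}$ with natural projection $q:L'\to L$, the ordered set $\mathbb{O}_{p_L(x)}(q)$ is order-isomorphic to $O$. By convention $[0,1]^0$ is a singleton. *)

(* Defs.v *)
From HB Require Import structures.
From mathcomp Require Import all_boot all_order all_algebra.
From mathcomp Require Import generic_quotient interval_inference.
From mathcomp Require Import all_classical all_reals all_analysis.
From mathcomp Require Import ring lra.

Set Implicit Arguments.
Unset Strict Implicit.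
Unset Printing Implicit Defensive.

Import Order.TTheory GRing.Theory Num.Theory.
Import numFieldNormedType.Exports.

Local Open Scope classical_set_scope.
Local Open Scope ring_scope.
Local Open Scope quotient_scope.

Section ell2.
Variables (R : realType) (kappa : choiceType).
Implicit Types x y : kappa -> R^o.

Definition sqsum x : \bar R := \esum_(i in [set: kappa]) (x i ^+ 2)%:E.

Definition square_summable : {pred kappa -> R^o} :=
  fun x => `[< (sqsum x < +oo)%E >].

Lemma sqsum_ge0 x : (0 <= sqsum x)%E.
Proof. by apply: esum_ge0 => i _; rewrite lee_fin sqr_ge0. Qed.

Lemma esum_scale (c : R) (f : kappa -> R) : 0 <= c -> (forall i, 0 <= f i) ->
  \esum_(i in [set: kappa]) (c * f i)%:E =
  (c%:E * \esum_(i in [set: kappa]) (f i)%:E)%E.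
Proof.
have le (d : R) (g : kappa -> R) : 0 <= d -> (forall i, 0 <= g i) ->
    (\esum_(i in [set: kappa]) (d * g i)%:E <=
     d%:E * \esum_(i in [set: kappa]) (g i)%:E)%E.
  move=> d0 g0; apply: ge_ereal_sup => _ [X [finX XT] <-].
  under eq_fsbigr do rewrite EFinM.
  rewrite -ge0_mule_fsumr; last by move=> i; rewrite lee_fin.
  by apply: lee_wpmul2l; [rewrite lee_fin|apply: esum_ge; exists X].
move=> c0 f0; apply/eqP; rewrite eq_le le//=.
have [->|cn0] := eqVneq c 0.
  by rewrite mul0e esum_ge0// => i _; rewrite mul0r.
have {cn0}c0 : 0 < c by rewrite lt_neqAle eq_sym cn0.
have := le c^-1 (fun i => c * f i); rewrite invr_ge0 (ltW c0) => /(_ isT).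
have cf0 i : 0 <= c * f i by rewrite mulr_ge0// ltW.
move=> /(_ cf0); under eq_esum do rewrite mulKf ?gt_eqF//.
by rewrite lee_pdivlMl.
Qed.

Lemma sqsum0 : sqsum 0 = 0%E.
Proof. by apply: esum1 => i _; rewrite expr0n. Qed.

Lemma sqsumZ (a : R) x : sqsum (a *: x) = ((a ^+ 2)%:E * sqsum x)%E.
Proof.
rewrite -esum_scale ?sqr_ge0//; last by move=> i; exact: sqr_ge0.
by apply: eq_esum => i _; rewrite -exprMn.
Qed.

Lemma le_sqsumD (c d : R) x y : 0 <= c -> 0 <= d ->
  (forall i, (x i + y i) ^+ 2 <= c * x i ^+ 2 + d * y i ^+ 2) ->
  (sqsum (x + y)%R <= c%:E * sqsum x + d%:E * sqsum y)%E.
Proof.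
move=> c0 d0 h; rewrite -!esum_scale//; try by move=> i; exact: sqr_ge0.
rewrite -esumD; first last.
- by move=> i _; rewrite lee_fin mulr_ge0// sqr_ge0.
- by move=> i _; rewrite lee_fin mulr_ge0// sqr_ge0.
by apply: le_esum => i _; rewrite -EFinD lee_fin; exact: h.
Qed.

Lemma square_summable_submod_closed : submod_closed square_summable.
Proof.
split=> [|a x y]; first by apply/asboolP; rewrite sqsum0.
move=> /asboolP xfin /asboolP yfin; apply/asboolP.
have le2 : (sqsum (a *: x + y)%R <= 2%:E * sqsum (a *: x)%R + 2%:E * sqsum y)%E.
  apply: le_sqsumD => // i; set u := (a *: x) i; set v := y i.
  rewrite -subr_ge0 [leRHS](_ : _ = (u - v) ^+ 2) ?sqr_ge0//; ring.
apply: (le_lt_trans le2); rewrite sqsumZ.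
by rewrite lte_add_pinfty// !lte_mul_pinfty// ?mule_ge0// lee_fin// sqr_ge0.
Qed.

HB.instance Definition _ := GRing.isSubmodClosed.Build R (kappa -> R^o)
  square_summable square_summable_submod_closed.

Record ell2 := Ell2 { ell2_fun :> kappa -> R^o ;
                      ell2P : ell2_fun \in square_summable }.

HB.instance Definition _ := [isSub for ell2_fun].
HB.instance Definition _ := [Choice of ell2 by <:].
HB.instance Definition _ := [SubChoice_isSubLmodule of ell2 by <:].

Definition ell2_norm (x : ell2) : R := Num.sqrt (fine (sqsum x)).

Lemma sqsum_norm (x : ell2) : sqsum x = (ell2_norm x ^+ 2)%:E.
Proof.
have /asboolP xfin := ell2P x.
rewrite sqr_sqrtr ?fine_ge0 ?sqsum_ge0// fineK// ge0_fin_numE//.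
exact: sqsum_ge0.
Qed.

Lemma ell2_norm_ge0 (x : ell2) : 0 <= ell2_norm x.
Proof. exact: sqrtr_ge0. Qed.

Lemma ell2_norm_eq0 (x : ell2) : ell2_norm x = 0 -> x = 0.
Proof.
move=> x0; apply/val_inj/funext => i.
have : ((x i ^+ 2)%:E <= sqsum x)%E.
  by apply: esum_ge; exists [set i] => //; rewrite fsbig_set1.
rewrite sqsum_norm x0 expr0n/= lee_fin => xi0.
by apply/eqP; rewrite -sqrf_eq0 eq_le xi0 sqr_ge0.
Qed.

Lemma ell2_normZ (a : R) (x : ell2) : ell2_norm (a *: x) = `|a| * ell2_norm x.
Proof.
rewrite /ell2_norm (_ : sqsum (a *: x) = ((a ^+ 2)%:E * sqsum x)%E).
  by rewrite sqsum_norm -EFinM/= sqrtrM ?sqr_ge0// !sqrtr_sqr.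
exact: sqsumZ.
Qed.

Lemma ler_ell2_normD (x y : ell2) :
  ell2_norm (x + y) <= ell2_norm x + ell2_norm y.
Proof.
have [/ell2_norm_eq0 ->|x0] := eqVneq (ell2_norm x) 0.
  by rewrite add0r lerDr ell2_norm_ge0.
have [/ell2_norm_eq0 ->|y0] := eqVneq (ell2_norm y) 0.
  by rewrite addr0 lerDl ell2_norm_ge0.
set a := ell2_norm x in x0 *; set b := ell2_norm y in y0 *.
have {x0}a0 : 0 < a by rewrite lt_neqAle eq_sym x0 ell2_norm_ge0.
have {y0}b0 : 0 < b by rewrite lt_neqAle eq_sym y0 ell2_norm_ge0.
have ab0 : 0 <= a + b by rewrite addr_ge0// ltW.
suff : ell2_norm (x + y) ^+ 2 <= (a + b) ^+ 2.
  by rewrite ler_pXn2r// nnegrE// ell2_norm_ge0.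
rewrite -lee_fin -sqsum_norm.
have ca : 0 <= (a + b) / a by rewrite divr_ge0// ltW// addr_gt0.
have cb : 0 <= (a + b) / b by rewrite divr_ge0// ltW// addr_gt0.
apply: (@le_trans _ _ (((a + b) / a)%:E * sqsum x + ((a + b) / b)%:E * sqsum y)%E).
  apply: le_sqsumD => // i.
  have h (u v : R) : (u + v) ^+ 2 <= (a + b) / a * u ^+ 2 + (a + b) / b * v ^+ 2.
    rewrite -subr_ge0 [leRHS](_ : _ = (b * u - a * v) ^+ 2 / (a * b)).
      by rewrite divr_ge0// ?sqr_ge0// mulr_ge0// ltW.
    by field; rewrite !gt_eqF.
  exact: h.
rewrite !sqsum_norm -/a -/b -!EFinM -EFinD lee_fin.
rewrite le_eqVlt; apply/orP; left; apply/eqP.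
by field; rewrite !gt_eqF.
Qed.

HB.instance Definition _ := Lmodule_isNormed.Build R ell2
  ler_ell2_normD ell2_normZ ell2_norm_eq0.

End ell2.

Section weak.
Variables (R : realType) (V : normedModType R).

Definition topological_dual : set {linear V -> R^o} :=
  [set phi | continuous phi].

Definition weak : Type := V.

Definition weak_eval (x : V) : {ptws topological_dual -> R} :=
  fun phi => val phi x.

HB.instance Definition _ := Topological.copy weak (initial_topology weak_eval).

Definition unit_ball : set weak := [set x | `|x : V| <= 1].

End weak.

(* Carries the subspace topology of the weak topology. *)
Definition ell2_ball (R : realType) (kappa : choiceType) : topologicalType :=
  set_type (@unit_ball R (ell2 R kappa)).

Definition hnorm (R : realType) (kappa : choiceType) (x : ell2_ball R kappa) : R :=
  `|(val x : ell2 R kappa)|.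

Section fiber_order.
Variables (K L : topologicalType) (f : K -> L) (y : L).

Definition fiber := set_type (f @^-1` [set y]).

(* U and V are neighborhoods in K, not in the fiber. *)
Definition fiber_le (s t : fiber) : Prop :=
  forall U, nbhs (val s) U ->
    exists2 V, nbhs (val t) V & f @` V `<=` f @` U.

Lemma fiber_le_refl s : fiber_le s s.
Proof. by move=> U sU; exists U. Qed.

Lemma fiber_le_trans s t u : fiber_le s t -> fiber_le t u -> fiber_le s u.
Proof.
move=> st tu U /st[V /tu[W uW WV] VU]; exists W => //.
exact: subset_trans WV VU.
Qed.

Definition fiber_eqv : rel fiber :=
  fun s t => `[< fiber_le s t /\ fiber_le t s >].

Lemma fiber_eqv_refl : reflexive fiber_eqv.
Proof. by move=> s; apply/asboolP; split; exact: fiber_le_refl. Qed.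

Lemma fiber_eqv_sym : symmetric fiber_eqv.
Proof. by move=> s t; apply/asboolP/asboolP => -[]. Qed.

Lemma fiber_eqv_trans : transitive fiber_eqv.
Proof.
move=> t s u /asboolP[st ts] /asboolP[tu ut]; apply/asboolP.
by split; [exact: fiber_le_trans tu|exact: fiber_le_trans ts].
Qed.

Canonical fiber_eqv_equiv :=
  EquivRel fiber_eqv fiber_eqv_refl fiber_eqv_sym fiber_eqv_trans.

Definition fiber_order : Type := {eq_quot fiber_eqv}.

HB.instance Definition _ := Choice.on fiber_order.
HB.instance Definition _ := EqQuotient.on fiber_order.

Definition fiber_order_le : rel fiber_order :=
  fun a b => `[< fiber_le (repr a) (repr b) >].

Lemma fiber_repr_pi (s : fiber) :
  fiber_le s (repr (\pi_fiber_order s)) /\ fiber_le (repr (\pi_fiber_order s)) s.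
Proof.
have /eqmodP/asboolP[] : repr (\pi_fiber_order s) = s %[mod fiber_order].
  by rewrite reprK.
by [].
Qed.

Lemma fiber_order_le_refl : reflexive fiber_order_le.
Proof. by move=> a; apply/asboolP; exact: fiber_le_refl. Qed.

Lemma fiber_order_le_anti : antisymmetric fiber_order_le.
Proof.
move=> a b /andP[/asboolP ab /asboolP ba].
by rewrite -[a]reprK -[b]reprK; apply/eqmodP/asboolP.
Qed.

Lemma fiber_order_le_trans : transitive fiber_order_le.
Proof.
by move=> b a c /asboolP ab /asboolP bc; apply/asboolP; exact: fiber_le_trans bc.
Qed.

HB.instance Definition _ := Order.Le_isPOrder.Build Order.default_display
  fiber_order fiber_order_le_refl fiber_order_le_anti fiber_order_le_trans.

Lemma fiber_order_leE (s t : fiber) :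
  (\pi_fiber_order s <= \pi_fiber_order t)%O <-> fiber_le s t.
Proof.
have [sr rs] := fiber_repr_pi s; have [tr rt] := fiber_repr_pi t.
split=> [/asboolP h|h].
  by apply: fiber_le_trans sr _; exact: fiber_le_trans h rt.
by apply/asboolP; apply: fiber_le_trans rs _; exact: fiber_le_trans h tr.
Qed.

End fiber_order.

Definition order_isomorphic d1 d2 (A : porderType d1) (B : porderType d2) :=
  exists2 phi : A -> B, bijective phi & {mono phi : a b / (a <= b)%O}.

(* Used instead of [equiv_rel], on which universe constraints forbid [set]. *)
Record equivalence (K : Type) := Equivalence {
  equivalence_graph : K -> K -> Prop;
  equivalence_refl : forall x, equivalence_graph x x;
  equivalence_sym : forall x y, equivalence_graph x y -> equivalence_graph y x;
  equivalence_trans : forall x y z, equivalence_graph x y ->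
    equivalence_graph y z -> equivalence_graph x z
}.

Section equivalence_rel.
Variables (K : Type) (E : equivalence K).

Definition equivalence_rel : rel K := fun x y => `[< equivalence_graph E x y >].

Lemma equivalence_rel_refl : reflexive equivalence_rel.
Proof. by move=> x; apply/asboolP; exact: equivalence_refl. Qed.

Lemma equivalence_rel_sym : symmetric equivalence_rel.
Proof. by move=> x y; apply/asboolP/asboolP; exact: equivalence_sym. Qed.

Lemma equivalence_rel_trans : transitive equivalence_rel.
Proof.
move=> y x z /asboolP xy /asboolP yz; apply/asboolP.
exact: equivalence_trans yz.
Qed.

Canonical equivalence_rel_equiv := EquivRel equivalence_rel
  equivalence_rel_refl equivalence_rel_sym equivalence_rel_trans.

End equivalence_rel.

Section quotients.
Variable K : topologicalType.

Definition quot (E : equivalence K) : topologicalType :=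
  quotient_topology {eq_quot (equivalence_rel E)}.

Definition proj_quot (E : equivalence K) : K -> quot E := \pi_(quot E).

Definition Qomega : set (equivalence K) :=
  [set E | hausdorff_space (quot E) /\ @second_countable (quot E)].

Definition natural_projection (L L' : equivalence K) (q : quot L' -> quot L) :=
  [/\ continuous q, set_surj setT setT q & q \o proj_quot L' = proj_quot L].

Definition quot_le (L L' : equivalence K) : Prop :=
  exists q : quot L' -> quot L, natural_projection q.

Definition quot_lt (L L' : equivalence K) : Prop := quot_le L L' /\ L <> L'.

Definition is_sup (A : set (equivalence K)) (M : equivalence K) : Prop :=
  [/\ Qomega M, forall L, A L -> quot_le L M &
      forall N, Qomega N -> (forall L, A L -> quot_le L N) -> quot_le M N].

Definition cofinal (S : set (equivalence K)) : Prop :=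
  forall L, Qomega L -> exists2 L', S L' & quot_le L L'.

(* Only nonempty countable subsets: the supremum of the empty set is the
   one-point quotient, and any fiber order over it is trivial. *)
Definition sigma_semilattice (S : set (equivalence K)) : Prop :=
  forall A, A `<=` S -> countable A -> A !=set0 ->
    exists2 M, is_sup A M & S M.

Definition has_order (x : K) d (O : porderType d) : Prop :=
  exists S : set (equivalence K),
    [/\ S `<=` Qomega, cofinal S, sigma_semilattice S &
      forall L L', S L -> S L' -> quot_lt L L' ->
      forall q : quot L' -> quot L, natural_projection q ->
        order_isomorphic (fiber_order q (proj_quot L x)) O].

End quotients.

(* Main.v *)
From HB Require Import structures.
Require Import Defs.
From mathcomp Require Import all_boot all_order all_algebra.
From mathcomp Require Import generic_quotient interval_inference finmap.
From mathcomp Require Import all_classical all_reals all_analysis.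
From mathcomp Require Import ring lra.

Set Implicit Arguments.
Unset Strict Implicit.
Unset Printing Implicit Defensive.

Import Order.TTheory GRing.Theory Num.Theory.
Import numFieldNormedType.Exports.

Local Open Scope classical_set_scope.
Local Open Scope ring_scope.
Local Open Scope quotient_scope.

(** Only the coordinates matter. On the unit ball the weak topology is the
    topology of coordinatewise convergence ([dual_coordinatewise],
    [nbhs_box]), so the power of the ball is compact and every metrizable
    quotient of it is determined by countably many coordinates
    ([countably_determined]). Hence the quotients [agree A], which identify two
    points when they have the same coordinates in [A], are cofinal when [A]
    ranges over the countable sets, and they are stable under countable
    suprema because these correspond to unions of the sets [A]. One may keep
    only the sets [A] that are infinite and carry the whole norm of every
    component of the base point [x].

    Take two such sets, [A] properly contained in [B], and let [q] be the
    restriction of coordinates from [B] to [A]. A point [s] of the fiber over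
    the image of [x] is given by its coordinates in [B \ A]; write m_i(s) for
    the sum of their squares in the i-th component. Near [s], the components in
    [B \ A] can be shrunk a little but their mass cannot drop much below
    m_i(s), so the image of a small neighborhood of [s] consists of the points
    close to the image of [x] on finitely many coordinates whose squared norm
    in component i is at most about 1 - m_i(s). As [A] is infinite, this bound
    is not implied by closeness on finitely many coordinates: mass can be put
    on a coordinate that the neighborhood does not see. Therefore [s] is below
    [t] exactly when m_i(s) <= m_i(t) for every i ([fiber_le_mass],
    [mass_fiber_le]). The numbers m_i(s) vary independently in the intervals
    [0, 1 - ||x_i||^2], because one coordinate of [B \ A] suffices to carry any
    prescribed mass. Such an interval is a point when ||x_i|| = 1 and is
    otherwise a copy of [0, 1] ([fiber_order_cube]). *)

(** * Mass of a vector on a set of coordinates *)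

Section mass.
Variables (R : realType) (kappa : choiceType).
Implicit Types (x y : ell2 R kappa) (A B : set kappa) (F : {fset kappa}).

(** Finite for vectors of the Hilbert space ([esum_mass]); working with squares
    keeps it additive over disjoint sets of coordinates. *)
Definition mass A x : R := fine (\esum_(k in A) (x k ^+ 2)%:E).

Lemma esum_sqr_ge0 A (f : kappa -> R) : (0 <= \esum_(k in A) (f k ^+ 2)%:E)%E.
Proof. by apply: esum_ge0 => k _; rewrite lee_fin sqr_ge0. Qed.

Lemma le_esum_sqr A B (f : kappa -> R) : A `<=` B ->
  (\esum_(k in A) (f k ^+ 2)%:E <= \esum_(k in B) (f k ^+ 2)%:E)%E.
Proof.
move=> AB; rewrite (esumID A B); last by move=> k _; rewrite lee_fin sqr_ge0.
by rewrite (setIidr AB) leeDl// esum_sqr_ge0.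
Qed.

Lemma esum_mass A x : \esum_(k in A) (x k ^+ 2)%:E = (mass A x)%:E.
Proof.
rewrite fineK// ge0_fin_numE ?esum_sqr_ge0//.
have /asboolP := ell2P x; apply: le_lt_trans.
exact: (@le_esum_sqr _ setT).
Qed.

Lemma mass_ge0 A x : 0 <= mass A x.
Proof. by rewrite fine_ge0// esum_sqr_ge0. Qed.

Lemma mass_norm x : mass setT x = `|x| ^+ 2.
Proof. by apply/EFin_inj; rewrite -esum_mass; exact: sqsum_norm. Qed.

Lemma massID B A x : mass A x = mass (A `&` B) x + mass (A `\` B) x.
Proof.
apply/EFin_inj; rewrite EFinD -!esum_mass (esumID B)//.
by move=> k _; rewrite lee_fin sqr_ge0.
Qed.

Lemma eq_mass A x y : (forall k, A k -> x k = y k) -> mass A x = mass A y.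
Proof. by move=> xy; congr fine; apply: eq_esum => k /xy ->. Qed.

Lemma le_mass A B x : A `<=` B -> mass A x <= mass B x.
Proof. by move=> AB; rewrite -lee_fin -!esum_mass le_esum_sqr. Qed.

Lemma massZ (c : R) A x : mass A (c *: x) = c ^+ 2 * mass A x.
Proof.
apply/EFin_inj; rewrite EFinM -!esum_mass.
rewrite esum_mkcond [in RHS]esum_mkcond.
have sqr_cond (y : ell2 R kappa) k : (if k \in A then (y k ^+ 2)%:E else 0%E) =
    (if k \in A then y k ^+ 2 else 0)%:E :> \bar R by case: ifP.
under eq_esum do rewrite sqr_cond.
under [in RHS]eq_esum do rewrite sqr_cond.
rewrite -esum_scale ?sqr_ge0//; last by move=> k; case: ifP; rewrite ?sqr_ge0.
by apply: eq_esum => k _; case: ifP; rewrite ?mulr0// -exprMn.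
Qed.

Lemma mass1 k x : mass [set k] x = x k ^+ 2.
Proof. by rewrite /mass esum_set1// lee_fin sqr_ge0. Qed.

Lemma mass_fset F x : mass [set` F] x = \sum_(k <- F) x k ^+ 2.
Proof.
rewrite /mass esum_fset; last by move=> k _; rewrite lee_fin sqr_ge0.
  by rewrite fsbig_finite//= set_fsetK sumEFin.
exact: finite_fset.
Qed.

Lemma fsum_sqr_le_mass F A x : [set` F] `<=` A ->
  \sum_(k <- F) x k ^+ 2 <= mass A x.
Proof. by move=> FA; rewrite -mass_fset le_mass. Qed.

Lemma mass_approx A x (c : R) : c < mass A x ->
  exists2 F : {fset kappa}, [set` F] `<=` A & c < \sum_(k <- F) x k ^+ 2.
Proof.
rewrite -lte_fin -esum_mass => /ereal_sup_gt[_ [X [finX XA] <-]].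
rewrite fsbig_finite//= sumEFin lte_fin => cX.
by exists (fset_set X) => // k; rewrite /= in_fset_set// inE => /XA.
Qed.

(** All the points built below come from this lemma: their coordinates are
    prescribed on two disjoint sets and vanish elsewhere, so that the norm is
    the sum of two masses. The functions [f] and [g] need not be vectors, which
    allows [g] to be a constant on a single coordinate. *)
Lemma ell2_glue A B (f g : kappa -> R) (a b : R) : [disjoint A & B] ->
    \esum_(k in A) (f k ^+ 2)%:E = a%:E -> \esum_(k in B) (g k ^+ 2)%:E = b%:E ->
  exists w : ell2 R kappa, [/\ forall k, A k -> w k = f k,
    forall k, B k -> w k = g k,
    forall k, ~ A k -> ~ B k -> w k = 0 & mass setT w = a + b].
Proof.
move=> /disj_setPS AB fa gb.
pose w0 k : R := if k \in A then f k else if k \in B then g k else 0.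
have w0A k : A k -> w0 k = f k by move=> Ak; rewrite /w0 (mem_set Ak).
have w0B k : B k -> w0 k = g k.
  move=> Bk; rewrite /w0 (mem_set Bk) ifF//; apply/negP => /set_mem Ak.
  exact: (AB k).
have w0C k : ~ A k -> ~ B k -> w0 k = 0.
  by move=> nA nB; rewrite /w0 (memNset nA) (memNset nB).
have w0ab : \esum_(k in setT) (w0 k ^+ 2)%:E = (a + b)%:E.
  have w2ge0 (D : set kappa) : forall k, D k -> (0 <= (w0 k ^+ 2)%:E)%E.
    by move=> k _; rewrite lee_fin sqr_ge0.
  rewrite (esumID A _ _ (w2ge0 setT)) !setTI [X in (_ + X)%E](esumID B _ _ (w2ge0 _)).
  rewrite [X in (_ + (_ + X))%E]esum1; last first.
    by move=> k [Ak Bk]; rewrite w0C// expr0n.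
  rewrite adde0 EFinD -fa -gb; congr (_ + _)%E.
    by apply: eq_esum => k /w0A ->.
  rewrite (_ : ~` A `&` B = B); first by apply: eq_esum => k /w0B ->.
  by apply/setIidr => k Bk Ak; exact: (AB k).
have w0P : (w0 : kappa -> R^o) \in @square_summable R kappa.
  by apply/asboolP; rewrite /sqsum w0ab ltry.
by exists (Ell2 w0P); split => //; rewrite /mass w0ab.
Qed.

Lemma ell2_restrict A x : exists w : ell2 R kappa,
  [/\ forall k, A k -> w k = x k, forall k, ~ A k -> w k = 0 &
      mass setT w = mass A x].
Proof.
have [||w [wA _ w0 wm]] := @ell2_glue A set0 x (fun=> 0) _ 0 _ (esum_mass A x).
- by apply/disj_setPS; rewrite setI0.
- by rewrite esum_set0.
- by exists w; split => // [k Ak|]; [apply: w0|rewrite wm addr0].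
Qed.

End mass.

(** * Weak continuity on bounded sets is coordinatewise *)

Section weak_functionals.
Variables (R : realType) (kappa : choiceType).
Local Notation l2 := (ell2 R kappa).
Implicit Types (u v x y z : l2) (F : {fset kappa}).

Lemma ell2_split F z : exists zF zC : l2,
  [/\ z = zF + zC, mass setT zF = mass [set` F] z,
      mass setT zC = mass (~` [set` F]) z,
      forall k, ~ [set` F] k -> zF k = 0 & forall k, [set` F] k -> zC k = 0].
Proof.
have [zF [zF1 zF0 zFm]] := ell2_restrict [set` F] z.
have [zC [zC1 zC0 zCm]] := ell2_restrict (~` [set` F]) z.
exists zF, zC; split => // [|k Fk]; last by apply: zC0; apply.
apply/val_inj/funext => k; change (z k = zF k + zC k).
have [Fk|nFk] := pselect ([set` F] k).
  by rewrite zF1// zC0 ?addr0// => /(_ Fk).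
by rewrite zF0// zC1// add0r.
Qed.

(** Let M be the norm of [phi] and let [u] be a vector of the ball at which [phi] is
    within t^2 of M; up to another M t^2, the vector [u] may be replaced by its
    part on a finite set [F]. If [w] is in the ball and vanishes on [F], then
    ||u + t w||^2 <= 1 + t^2 by orthogonality, so that
    phi(u) + t phi(w) <= M (1 + t^2), whence phi(w) <= t (1 + 2 M). This avoids
    representing [phi] by a vector. *)
Lemma dual_tail (phi : {linear l2 -> R^o}) : continuous phi ->
  forall e : R, 0 < e -> exists F : {fset kappa},
    forall v, (forall k, k \in F -> v k = 0) ->
    `|v| <= 1 -> `|phi v| <= e.
Proof.
move=> cphi e e0.
have [C Cphi] : exists C : R, forall v : l2, `|v| <= 1 -> `|phi v| <= C.
  by have /bounded_funP/(_ 1) := continuous_linear_bounded 0 (cphi 0).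
pose E := [set phi u | u in [set u : l2 | `|u| <= 1]].
have supE : has_sup E.
  split; first by exists (phi 0), 0 => //=; rewrite normr0.
  by exists C => _ [u /= u1 <-]; exact: le_trans (ler_norm _) (Cphi _ u1).
pose M := sup E.
have phiM u : `|u| <= 1 -> phi u <= M.
  by move=> u1; apply: ub_le_sup; [case: supE|exists u].
have M0 : 0 <= M by rewrite -(linear0 phi) phiM// normr0.
have phi_le u : phi u <= M * `|u|.
  have [->|u0] := eqVneq u 0; first by rewrite linear0 normr0 mulr0.
  have nu0 : 0 < `|u| by rewrite normr_gt0.
  have := phiM (`|u|^-1 *: u); rewrite normrZ gtr0_norm ?invr_gt0//.
  rewrite mulVf ?gt_eqF// => /(_ (lexx _)); rewrite linearZ/=.
  by rewrite -[_ *: _]/(_ * _) mulrC ler_pdivrMr.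
(* The estimate below is phi w <= t * (1 + 2 * M). *)
pose t := e / (1 + 2 * M).
have M1 : 0 < 1 + 2 * M by rewrite ltr_wpDr ?mulr_ge0.
have t0 : 0 < t by rewrite divr_gt0.
have [_ [u u1 <-] phiu] := sup_adherent (exprn_gt0 2 t0) supE.
rewrite -/M in phiu.
have mass1 : mass setT u <= 1 by rewrite mass_norm expr_le1.
have [F _ uF] : exists2 F : {fset kappa}, [set` F] `<=` setT &
    mass setT u - (t ^+ 2) ^+ 2 < \sum_(k <- F) u k ^+ 2.
  by apply: mass_approx; rewrite ltrBlDr ltrDl !exprn_gt0.
exists F => v vF v1.
suff main (w : l2) : (forall k, k \in F -> w k = 0) -> `|w| <= 1 -> phi w <= e.
  rewrite ler_norml main// andbT lerNl -linearN main ?normrN// => k /vF vk.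
  by change (- v k = 0); rewrite vk oppr0.
move=> {v vF v1} wF w1.
have [uF' [uC [uE uFm uCm uF0 uC0]]] := ell2_split F u.
have phiuC : phi uC <= M * t ^+ 2.
  apply: le_trans (phi_le _) _; rewrite ler_wpM2l//.
  rewrite -(@ler_pXn2r _ 2)// ?nnegrE// ?exprn_ge0 ?(ltW t0)//.
  rewrite -mass_norm uCm.
  move: uF; rewrite -mass_fset (massID [set` F] setT u) setTI setTD; lra.
have wm : mass setT (uF' + t *: w) <= 1 + t ^+ 2.
  rewrite (massID [set` F]) setTI setTD lerD//.
    rewrite (@eq_mass _ _ _ _ uF'); last first.
      by move=> k Fk; change (uF' k + t * w k = uF' k); rewrite wF// mulr0 addr0.
    rewrite (le_trans (le_mass _ (@subsetT _ _)))// uFm.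
    by rewrite (le_trans (le_mass _ (@subsetT _ _))).
  rewrite (@eq_mass _ _ _ _ (t *: w)); last first.
    by move=> k Fk; change (uF' k + t * w k = t * w k); rewrite uF0// add0r.
  rewrite massZ ler_piMr ?exprn_ge0 ?(ltW t0)//.
  by rewrite (le_trans (le_mass _ (@subsetT _ _)))// mass_norm expr_le1.
(* The bound sqrt (1 + t^2) <= 1 + t^2 is enough here. *)
have : phi (uF' + t *: w) <= M * (1 + t ^+ 2).
  apply: le_trans (phi_le _) _; rewrite ler_wpM2l//.
  move: wm; rewrite mass_norm; set s := `|_|; nra.
rewrite linearD linearZ/=.
have -> : phi uF' = phi u - phi uC by rewrite uE linearD addrK.
rewrite -[_ *: _]/(t * phi w) => h.
have : t * phi w <= t * e.
  have te : t * (1 + 2 * M) = e by rewrite /t mulfVK ?gt_eqF.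
  rewrite -te; lra.
by rewrite ler_pM2l.
Qed.

(** The difference of two points of the ball that are close on [F] splits into
    a part on [F], of small norm, and a part off [F], of norm at most 2, on
    which [dual_tail] applies. *)
Lemma dual_coordinatewise (phi : {linear l2 -> R^o}) : continuous phi ->
  forall e : R, 0 < e -> exists F : {fset kappa}, exists2 eta : R, 0 < eta &
    forall x y, `|x| <= 1 -> `|y| <= 1 ->
      (forall k, k \in F -> `|x k - y k| < eta) -> `|phi x - phi y| < e.
Proof.
move=> cphi e e0.
have e8 : 0 < e / 8 by rewrite divr_gt0.
have [F Fphi] := dual_tail cphi e8.
have [d d0 dphi] : exists2 d : R, 0 < d &
    forall u, `|u| < d -> `|phi u| < e / 2.
  have e2 : 0 < e / 2 by rewrite divr_gt0.
  have /cvgrPdist_lt /(_ _ e2)/nbhs_ballP[d d0 dphi] := cphi 0.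
  exists d => // u ud; have := dphi u; rewrite linear0 sub0r normrN; apply.
  by rewrite -ball_normE/= sub0r normrN.
pose N : R := (size F)%:R + 1.
have N1 : 1 <= N by rewrite lerDr.
exists F, (d / N) => [|x y x1 y1 xy]; first by rewrite divr_gt0// (lt_le_trans _ N1).
have [zF [zC [zE zFm zCm zF0 zC0]]] := ell2_split F (x - y).
rewrite -linearB zE linearD.
have phiF : `|phi zF| < e / 2.
  apply: dphi; rewrite -(@ltr_pXn2r _ 2)// ?nnegrE ?(ltW d0)//.
  rewrite -mass_norm zFm mass_fset.
  apply: (@le_lt_trans _ _ (\sum_(k <- F) (d / N) ^+ 2)).
    rewrite big_seq [leRHS]big_seq; apply: ler_sum => k Fk.
    rewrite -[leLHS]real_normK ?num_real//.
    by rewrite lerXn2r ?nnegrE ?divr_ge0 ?(ltW d0) ?(le_trans _ N1)// ltW// xy.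
  rewrite big_const_seq count_predT iter_addr_0 expr_div_n -mulr_natr.
  have N0 : 0 < N by apply: lt_le_trans N1.
  rewrite -mulrA gtr_pMr ?exprn_gt0// mulrC ltr_pdivrMr ?exprn_gt0// mul1r.
  have sN : (size F)%:R < N by rewrite ltrDl.
  by apply: lt_le_trans sN _; rewrite expr2 ler_peMl// ltW.
have phiC : `|phi zC| <= e / 4.
  have zC2 : `|zC| <= 2.
    rewrite -(@ler_pXn2r _ 2)// ?nnegrE// -mass_norm zCm.
    apply: le_trans (le_mass _ (@subsetT _ _)) _.
    rewrite mass_norm lerXn2r ?nnegrE// (le_trans (ler_normB _ _))//.
    by rewrite -[leRHS]/(1 + 1) lerD.
  have := Fphi (2^-1 *: zC).
  rewrite normrZ gtr0_norm// linearZ/= -[_ *: phi zC]/(_ * _) normrM gtr0_norm//.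
  move=> h; suff : 2^-1 * `|phi zC| <= e / 8 by lra.
  apply: h; last lra.
  by move=> k Fk; change (2^-1 * zC k = 0); rewrite zC0// mulr0.
apply: le_lt_trans (ler_normD _ _) _; lra.
Qed.

End weak_functionals.

(** * The topology of a power of the ball *)

Section ball_power.
Variables (R : realType) (kappa : choiceType) (I : finType).
Local Notation l2 := (ell2 R kappa).
Local Notation X := {ptws I -> ell2_ball R kappa}.
Implicit Types (x y z : X) (U V : set X) (F : {fset I * kappa}).

Definition entry x i : l2 := val (x i).

Lemma entry_norm x i : `|entry x i| <= 1.
Proof. exact: set_mem (valP (x i)). Qed.

Lemma mass_entry A x i : mass A (entry x i) <= 1.
Proof.
rewrite (le_trans (le_mass _ (@subsetT _ _)))// mass_norm expr_le1//.
exact: entry_norm.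
Qed.

Lemma exists_entry (f : I -> l2) : (forall i, mass setT (f i) <= 1) ->
  exists x, forall i, entry x i = f i.
Proof.
move=> f1; have fP i : (f i : weak l2) \in @unit_ball R l2.
  by apply/mem_set; rewrite /unit_ball/= -(@expr_le1 _ 2)// -mass_norm.
by exists (fun i => exist _ (f i) (fP i)).
Qed.

Definition ell2_eval (k : kappa) (u : l2) : R^o := u k.

Lemma ell2_eval_linear k : linear (ell2_eval k).
Proof. by []. Qed.

HB.instance Definition _ k :=
  GRing.isLinear.Build R l2 R^o *:%R (ell2_eval k) (ell2_eval_linear k).

Lemma ell2_eval_continuous k : continuous (ell2_eval k).
Proof.
apply: bounded_linear_continuous; apply/bounded_funP => r; exists r => u ur.
apply: le_trans ur; rewrite -(@ler_pXn2r _ 2)// ?nnegrE// -mass_norm.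
rewrite real_normK ?num_real//.
by rewrite -[leLHS]mass1 le_mass.
Qed.

Lemma entry_continuous i k : continuous (fun x => entry x i k : R).
Proof.
pose ev : @topological_dual R l2 :=
  exist _ (ell2_eval k : {linear l2 -> R^o}) (mem_set (@ell2_eval_continuous k)).
move=> x.
apply: (@continuous_comp _ _ _ (fun x : X => x i)
  (fun u : ell2_ball R kappa => val u k)).
  exact: (@proj_continuous _ (fun _ => ell2_ball R kappa)).
apply: (@continuous_comp _ _ _ (fun u : ell2_ball R kappa => val u)
  (fun u : weak l2 => (u : l2) k)).
  exact: initial_continuous.
apply: (@continuous_comp (weak l2) {ptws @topological_dual R l2 -> R} R
  (@weak_eval R l2) (fun f => f ev)).
  exact: initial_continuous.
exact: (@proj_continuous _ (fun _ => R)).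
Qed.

Definition box x F (eta : R) : set X :=
  [set y | forall p, p \in F -> `|entry x p.1 p.2 - entry y p.1 p.2| < eta].

Lemma box_nbhs x F (eta : R) : 0 < eta -> nbhs x (box x F eta).
Proof.
move=> eta0.
have -> : box x F eta = \bigcap_(p in [set` F])
    [set y | `|entry x p.1 p.2 - entry y p.1 p.2| < eta] by [].
apply: filter_bigI => p _.
by have /cvgrPdist_lt := @entry_continuous p.1 p.2 x; apply.
Qed.

(** By definition of the weak and product topologies it is enough that every
    continuous functional of every component converges along the filter
    generated by the boxes around [x], which is [dual_coordinatewise]. *)
Lemma nbhs_box x U : nbhs x U ->
  exists F, exists2 eta : R, 0 < eta & box x F eta `<=` U.
Proof.
pose B : set_system X :=
  [set V | exists F, exists2 eta : R, 0 < eta & box x F eta `<=` V].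
have FB : Filter B.
  split.
  - by exists fset0, 1.
  - move=> V W [F [d d0 FV]] [G [e e0 GW]].
    exists (F `|` G)%fset, (Num.min d e); first by rewrite lt_min d0.
    move=> y xy; split; [apply: FV|apply: GW] => p pF.
      by have := xy p; rewrite inE pF lt_min => /(_ isT)/andP[].
    by have := xy p; rewrite inE pF orbT lt_min => /(_ isT)/andP[].
  - by move=> V W VW [F [d d0 FV]]; exists F, d => //; exact: subset_trans VW.
suff : B --> x by apply.
apply/cvg_sup => i.
move=> N [_ [[V oV <-]] /= Vx sub]; apply: filterS sub _.
have : nbhs (x i) V by apply: open_nbhs_nbhs.
move=> [_ [[W oW <-]] /= Wx WV].
apply: filterS (fun (y : X) => WV (y i)) _.
have : nbhs (val (x i) : weak l2) W by apply: open_nbhs_nbhs.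
move=> [_ [[T oT <-]] /= Tx TW].
apply: filterS (fun (y : X) => TW (val (y i))) _.
suff /(_ T) : (fun y : X => weak_eval (val (y i))) @ B --> weak_eval (val (x i)).
  by apply; apply: open_nbhs_nbhs.
apply/cvg_sup => -[phi phiP].
move=> N' [_ [[S oS <-]] /= Sx sub]; apply: filterS sub _.
suff : (fun y : X => phi (entry y i)) @ B --> phi (entry x i).
  by apply; apply: open_nbhs_nbhs.
have cphi : continuous phi := set_mem phiP.
apply/cvgrPdist_lt => e e0.
have [F [eta eta0 h]] := dual_coordinatewise cphi e0.
exists [fset (i, k) | k in F]%fset, eta => // y xy.
apply: h; [exact: entry_norm..|move=> k kF].
by apply: (xy (i, k)); apply/imfsetP; exists k.
Qed.

(** Along an ultrafilter every coordinate converges, since it stays in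
    [-1, 1]. The family of limits is again a point of the power of the ball,
    as the bounds on finite sums of squares pass to the limit, and the
    ultrafilter converges to it because neighborhoods contain boxes. *)
Lemma compact_ball_power : compact [set: X].
Proof.
rewrite compact_ultra => G UG _ /=.
have lim_entry p : exists c : R, (fun z : X => entry z p.1 p.2) @ G --> c.
  have [|c [_ Gc]] := @segment_compact R (-1) 1 ((fun z : X => entry z p.1 p.2) @ G) _.
    apply: (@filterE _ G) => z /=; rewrite in_itv/= -ler_norml.
    rewrite -(@expr_le1 _ 2)// real_normK ?num_real//.
    rewrite -[leLHS]mass1; exact: mass_entry.
  exists c; apply/cvgrPdist_lt => e e0.
  have [//|GC] := in_ultra_setVsetC [set z : X | `|c - entry z p.1 p.2| < e] UG.
  have ce : nbhs c [set r | `|c - r| < e].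
    by have := @nbhsx_ballx _ _ c e e0; rewrite -ball_normE.
  by have [r []] := Gc (~` [set r | `|c - r| < e]) _ GC ce.
pose c p : R := projT1 (cid (lim_entry p)).
have Gc p : (fun z : X => entry z p.1 p.2) @ G --> c p.
  exact: projT2 (cid (lim_entry p)).
have csum i : (\esum_(k in setT) (c (i, k) ^+ 2)%:E <= 1)%E.
  apply: ge_ereal_sup => _ [A [finA _] <-].
  rewrite fsbig_finite//= sumEFin lee_fin.
  have cv : (fun z : X => \sum_(k <- fset_set A) entry z i k ^+ 2) @ G -->
      (\sum_(k <- fset_set A) c (i, k) ^+ 2).
    apply: cvg_big => [|k _]; first exact: add_continuous.
    under eq_cvg do rewrite expr2.
    by rewrite expr2; apply: cvgM; exact: (Gc (i, k)).
  rewrite -(cvg_lim _ cv)//; apply: limr_le; first by apply/cvg_ex; eexists; exact: cv.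
  apply: nearW => z; apply: le_trans (mass_entry setT z i).
  exact: fsum_sqr_le_mass.
have cP i : (fun k => c (i, k) : R^o) \in @square_summable R kappa.
  apply/asboolP; exact: le_lt_trans (csum i) (ltry _).
have [i|x xc] := @exists_entry (fun i => Ell2 (cP i)).
  by rewrite -lee_fin -esum_mass; exact: csum.
exists x; split => //.
move=> U /nbhs_box[F [eta eta0 FU]]; apply: filterS FU _.
have -> : box x F eta = \bigcap_(p in [set` F])
    [set y | `|entry x p.1 p.2 - entry y p.1 p.2| < eta] by [].
apply: filter_bigI => p _.
have /cvgrPdist_lt/(_ _ eta0) := Gc p; rewrite xc/=.
by case: p.
Qed.

End ball_power.

(** * Quotients that keep a set of coordinates *)

Section quotient_facts.
Variable K : topologicalType.
Implicit Types (E L : equivalence K) (x y : K).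

Lemma proj_quotP E x y : proj_quot E x = proj_quot E y <-> equivalence_graph E x y.
Proof.
split=> [/eqmodP/asboolP//|xy].
by apply/eqmodP/asboolP.
Qed.

Lemma repr_quotK E (q : quot E) : proj_quot E (repr q) = q.
Proof. exact: reprK. Qed.

Lemma repr_proj_quot E x : equivalence_graph E (repr (proj_quot E x)) x.
Proof. by apply/proj_quotP; rewrite repr_quotK. Qed.

Lemma proj_quot_continuous E : continuous (proj_quot E).
Proof. exact: pi_continuous. Qed.

(** The map between quotients is induced on classes, and its continuity is
    automatic for quotient topologies. *)
Lemma quot_leP L L' : quot_le L L' <->
  forall x y, equivalence_graph L' x y -> equivalence_graph L x y.
Proof.
split=> [[q [_ _ qE]] x y /proj_quotP xy|LL'].
  by apply/proj_quotP; rewrite -qE /= xy.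
exists (fun u => proj_quot L (repr u)).
have E : (fun u => proj_quot L (repr u)) \o proj_quot L' = proj_quot L.
  by apply/funext => x; apply/proj_quotP/LL'/repr_proj_quot.
split => //.
- apply/quotient_continuous.
  change (continuous ((fun u => proj_quot L (repr u)) \o proj_quot L')).
  by rewrite E; exact: proj_quot_continuous.
- move=> u _; exists (proj_quot L' (repr u)) => //.
  by have := congr1 (fun f => f (repr u)) E; rewrite /= repr_quotK.
Qed.

End quotient_facts.

Section coordinate_quotients.
Variables (R : realType) (kappa : choiceType) (I : finType).
Local Notation l2 := (ell2 R kappa).
Local Notation X := {ptws I -> ell2_ball R kappa}.
Implicit Types (x y z : X) (F : {fset I * kappa}) (A B : set kappa).

Lemma exists_rows (P : I -> l2 -> Prop) :
  (forall i, exists2 w, P i w & mass setT w <= 1) ->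
  exists x : X, forall i, P i (entry x i).
Proof.
move=> /(_ _)/cid2-/all_sig2[f fP f1].
by have [x xf] := exists_entry f1; exists x => i; rewrite xf.
Qed.

Lemma exists_restriction A x : exists z, forall i,
  (forall k, A k -> entry z i k = entry x i k) /\
  (forall k, ~ A k -> entry z i k = 0).
Proof.
apply: (exists_rows (P := fun i w => (forall k, A k -> w k = entry x i k) /\
  (forall k, ~ A k -> w k = 0))) => i.
have [w [wA w0 wm]] := ell2_restrict A (entry x i).
by exists w => //; rewrite wm mass_entry.
Qed.

Definition agree_graph A x y := forall i k, A k -> entry x i k = entry y i k.

(** The relation whose quotient is the power of the ball over the coordinates
    in [A]. *)
Definition agree A : equivalence X.
Proof.
exists (agree_graph A) => [//|x y xy i k Ak|x y z xy yz i k Ak].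
  by rewrite xy.
by rewrite xy// yz.
Defined.

Lemma entry_repr A x i k : A k ->
  entry (repr (proj_quot (agree A) x)) i k = entry x i k.
Proof. exact: (@repr_proj_quot _ (agree A)). Qed.

Lemma entry_repr_continuous A i k : A k ->
  continuous (fun q : quot (agree A) => entry (repr q) i k : R).
Proof.
move=> Ak; apply/quotient_continuous.
rewrite (_ : _ \o _ = fun x => entry x i k); first exact: entry_continuous.
by apply/funext => x; exact: entry_repr.
Qed.

Lemma quot_box_nbhs A x F (eta : R) : 0 < eta ->
  nbhs (proj_quot (agree A) x) [set q | forall p, p \in F -> A p.2 ->
    `|entry x p.1 p.2 - entry (repr q) p.1 p.2| < eta].
Proof.
move=> eta0.
set S := (S in nbhs _ S).
have -> : S = \bigcap_(p in [set` F]) [set q | A p.2 ->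
    `|entry x p.1 p.2 - entry (repr q) p.1 p.2| < eta] by [].
apply: filter_bigI => p _.
have [Ap|nAp] := pselect (A p.2); last by apply: filterE => q /nAp.
have /cvgrPdist_lt/(_ _ eta0) := @entry_repr_continuous A p.1 p.2 Ap (proj_quot (agree A) x).
by rewrite entry_repr//; apply: filterS => q /= h _.
Qed.

(** Setting the coordinates outside [A] to zero does not change the class of a
    point. Thus a neighborhood of the class of [x] contains the classes of a box
    around the truncation of [x], where the conditions at coordinates outside
    [A] hold for truncated points. *)
Lemma nbhs_quot_box A x (U : set (quot (agree A))) :
  nbhs (proj_quot (agree A) x) U -> exists F, exists2 eta : R, 0 < eta &
    forall y, (forall p, p \in F -> A p.2 ->
      `|entry x p.1 p.2 - entry y p.1 p.2| < eta) -> U (proj_quot (agree A) y).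
Proof.
have [rx rxA] := exists_restriction A x.
have -> : proj_quot (agree A) x = proj_quot (agree A) rx.
  by apply/proj_quotP => i k Ak; rewrite (rxA i).1.
move=> /proj_quot_continuous/nbhs_box[F [eta eta0 FU]].
exists F, eta => // y xy.
have [ry ryA] := exists_restriction A y.
have -> : proj_quot (agree A) y = proj_quot (agree A) ry.
  by apply/proj_quotP => i k Ak; rewrite (ryA i).1.
apply: FU => p pF; have [Ap|nAp] := pselect (A p.2).
  by rewrite (rxA p.1).1// (ryA p.1).1//; exact: xy.
by rewrite (rxA p.1).2// (ryA p.1).2// subrr normr0.
Qed.

Lemma quot_agree_hausdorff A : hausdorff_space (quot (agree A)).
Proof.
move=> p q pq; apply: contrapT => neq.
have [i [k [Ak ik]]] : exists i k, A k /\ entry (repr p) i k <> entry (repr q) i k.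
  apply: contrapT => h; apply: neq.
  rewrite -[p]repr_quotK -[q]repr_quotK; apply/proj_quotP => i k Ak.
  by apply: contrapT => ik; apply: h; exists i, k.
have d0 : 0 < `|entry (repr p) i k - entry (repr q) i k| / 2.
  by rewrite divr_gt0// normr_gt0 subr_eq0; apply/eqP.
have nb (r : quot (agree A)) := @quot_box_nbhs A (repr r) [fset (i, k)]%fset _ d0.
have := pq _ _ (eq_ind _ (nbhs^~ _) (nb p) _ (repr_quotK p))
  (eq_ind _ (nbhs^~ _) (nb q) _ (repr_quotK q)).
move=> [r [/(_ (i, k) (fset11 _) Ak)/= rp /(_ (i, k) (fset11 _) Ak)/= rq]].
move: rp rq; set a := entry _ i k; set b := entry _ i k; set c := entry _ i k.
have := ler_distD b a c; rewrite (distrC b c); lra.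
Qed.

(** A basis is given by finitely many conditions on coordinates in [A] with
    rational bounds. Coordinates are named by their codes under an injection
    [f] of [A] into the natural numbers, so that the conditions range over a
    countable type. *)
Lemma quot_agree_second_countable A : countable A ->
  @second_countable (quot (agree A)).
Proof.
move=> /countable_injP[f finj].
pose W (s : {fset (I * nat) * (rat * rat)}) : set (quot (agree A)) :=
  [set q | forall c, c \in s -> forall k, A k -> f k = c.1.2 ->
    ratr c.2.1 < entry (repr q) c.1.1 k < ratr c.2.2].
exists (range W).
  by apply: sub_countable (card_image_le _ _) _; exact: countableP.
split.
  move=> _ [s _ <-].
  have -> : W s = \bigcap_(c in [set` s]) [set q | forall k, A k ->
    f k = c.1.2 -> ratr c.2.1 < entry (repr q) c.1.1 k < ratr c.2.2] by [].
  rewrite openE => q Wq; apply: filter_bigI => c cs.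
  have [[k [Ak fk]]|nk] := pselect (exists k, A k /\ f k = c.1.2); last first.
    by apply: filterE => r k Ak fk; case: nk; exists k.
  have /andP[lq qr] := Wq c cs k Ak fk.
  have cvq := @entry_repr_continuous A c.1.1 k Ak q.
  near=> r => k' Ak'; rewrite -fk => /finj -> //; [|exact/mem_set..].
  by apply/andP; split; near: r; [exact: cvgr_gt cvq _ lq|exact: cvgr_lt cvq _ qr].
move=> q U; rewrite -{1}[q]repr_quotK => /nbhs_quot_box[F [eta eta0 FU]].
have rat_near (a : R) : exists ab : rat * rat,
    [/\ a - eta < ratr ab.1, ratr ab.1 < a, a < ratr ab.2 & ratr ab.2 < a + eta].
  have [l] : exists l : rat, ratr l \in `]a - eta, a[%R.
    by apply: rat_in_itvoo; rewrite ltrBlDr ltrDl.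
  have [r] : exists r : rat, ratr r \in `]a, a + eta[%R.
    by apply: rat_in_itvoo; rewrite ltrDl.
  by rewrite !in_itv/= => /andP[ar ra] /andP[al la]; exists (l, r).
pose ab a := projT1 (cid (rat_near a)).
have abP a : [/\ a - eta < ratr (ab a).1, ratr (ab a).1 < a,
    a < ratr (ab a).2 & ratr (ab a).2 < a + eta] := projT2 (cid (rat_near a)).
pose s := [fset ((p.1, f p.2), ab (entry (repr q) p.1 p.2)) |
  p in F & p.2 \in A]%fset.
exists (W s); last first.
  move=> r Wr; rewrite -[r]repr_quotK; apply: FU => p pF Ap.
  have /Wr/(_ _ Ap erefl)/= : ((p.1, f p.2), ab (entry (repr q) p.1 p.2)) \in s.
    by apply/imfsetP; exists p => //=; rewrite inE pF; exact/mem_set.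
  have [] := abP (entry (repr q) p.1 p.2).
  rewrite ltr_distlC => h1 h2 h3 h4 /andP[h5 h6].
  by apply/andP; split; lra.
split; first by exists s.
move=> _ /imfsetP[p + ->]/=; rewrite inE => /andP[pF /set_mem Ap] k Ak.
move=> /finj -> //; [|exact/mem_set..].
by have [] := abP (entry (repr q) p.1 p.2) => _ -> ->.
Unshelve. all: by end_near. Qed.

End coordinate_quotients.
Arguments agree {R kappa I} A.

(** * Metrizable quotients and countable sets of coordinates *)

Lemma countable_infinite_subset (T : Type) : infinite_set [set: T] ->
  exists2 N : set T, countable N & infinite_set N.
Proof.
elim/Ppointed: T => T; first by rewrite emptyE => /(_ (finite_set0 _)).
move=> /infiniteP/pcard_leP[f]; exists (f @` setT).
  by apply: sub_countable (card_image_le _ _) _; exact: countableP.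
by rewrite (eq_finite_set (card_image _)); exact: infinite_nat.
Qed.

Lemma countable_setU (T : Type) (A B : set T) :
  countable A -> countable B -> countable (A `|` B).
Proof.
move=> cA cB; rewrite -bigcup2E; apply: bigcup_countable => // i _.
by case: i => [|[|i]] /=.
Qed.

Section cofinality.
Variables (R : realType) (kappa : choiceType) (I : finType).
Local Notation X := {ptws I -> ell2_ball R kappa}.
Implicit Types (x y z : X) (F : {fset I * kappa}) (A B : set kappa).

Lemma Qomega_agree A : countable A -> Qomega (agree A : equivalence X).
Proof.
move=> cA; split; first exact: quot_agree_hausdorff.
exact: quot_agree_second_countable.
Qed.

(** Each point of [C] has a box disjoint from [D], so that the finitely many
    coordinates of this box tell the points of the box from those of [D].
    Compactness of [C] leaves finitely many coordinates in all; it is used as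
    near-covering, along the filter of large finite sets of coordinates. *)
Lemma closed_separation (C D : set X) : closed C -> closed D ->
  C `&` D `<=` set0 -> exists F : {fset I * kappa}, forall x y, C x -> D y ->
    exists2 p, p \in F & entry x p.1 p.2 <> entry y p.1 p.2.
Proof.
move=> cC cD CD.
have compC : compact C.
  exact: subclosed_compact cC (@compact_ball_power R kappa I) (@subsetT _ _).
pose large : set_system {fset I * kappa} :=
  [set W | exists F0 : {fset I * kappa}, forall F, (F0 `<=` F)%fset -> W F].
have large_filter : Filter large.
  split.
  - by exists fset0.
  - move=> V W [F VF] [G WG]; exists (F `|` G)%fset => H FGH; split.
      by apply: VF; apply: fsubset_trans FGH; exact: fsubsetUl.
    by apply: WG; apply: fsubset_trans FGH; exact: fsubsetUr.
  - by move=> V W VW [F VF]; exists F => G /VF/VW.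
move: compC; rewrite compact_near_coveringP => /(_ _ large (fun F x =>
  forall y, D y -> exists2 p, p \in F & entry x p.1 p.2 <> entry y p.1 p.2)).
case=> [x Cx|F /(_ F (fsubset_refl F)) FP]; last first.
  by exists F => x y Cx; exact: FP.
have /nbhs_box[F [eta eta0 FD]] : nbhs x (~` D).
  apply: open_nbhs_nbhs; split; first exact: closed_openC.
  by move=> Dx; apply: (CD x).
exists (box x F eta, [set G | (F `<=` G)%fset]).
  by split; [exact: box_nbhs|exists F].
move=> [z G] /= [xz FG] y Dy.
apply: contrapT => zy; apply: (FD y) => // p pF.
rewrite -(_ : entry z p.1 p.2 = entry y p.1 p.2); first exact: xz.
apply: contrapT => ne; apply: zy; exists p => //.
exact: (fsubsetP FG).
Qed.

(** The quotient is compact, hence regular: two distinct points have basic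
    neighborhoods with disjoint closures. For each of the countably many pairs
    of basic open sets with disjoint closures, [closed_separation] gives a
    finite set of coordinates that tells apart the preimages of the closures;
    the union of these sets determines the class of a point. *)
Lemma countably_determined (E : equivalence X) : Qomega E ->
  exists2 A, countable A & quot_le E (agree A).
Proof.
move=> [hE [B cB [Bo Bb]]].
have compE : compact [set: quot E].
  have -> : [set: quot E] = proj_quot E @` [set: X].
    by apply/seteqP; split=> // q _; exists (repr q) => //; exact: repr_quotK.
  apply: continuous_compact (@compact_ball_power R kappa I).
  by apply: continuous_subspaceT; exact: proj_quot_continuous.
have regE (q : quot E) : filter_from (nbhs q) closure --> q.
  by apply: (compact_regular hE compE); exact: filterT.
have ex_sep (UV : set (quot E) * set (quot E)) : exists F : {fset I * kappa},
    closure UV.1 `&` closure UV.2 `<=` set0 ->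
    forall x y, closure UV.1 (proj_quot E x) -> closure UV.2 (proj_quot E y) ->
    exists2 p, p \in F & entry x p.1 p.2 <> entry y p.1 p.2.
  have [dis|] := pselect (closure UV.1 `&` closure UV.2 `<=` set0);
    last by exists fset0.
  have cl (U : set (quot E)) : closed (proj_quot E @^-1` closure U).
    apply: preimage_closed; last exact: closed_closure.
    by move=> x _; exact: proj_quot_continuous.
  have [|F FP] := closed_separation (cl UV.1) (cl UV.2).
    by move=> x; exact: dis.
  by exists F => _ x y; exact: FP.
pose F UV := projT1 (cid (ex_sep UV)).
have FP UV := projT2 (cid (ex_sep UV)); rewrite -/(F _) in FP.
exists (\bigcup_(UV in B `*` B) [set p.2 | p in [set` F UV]]).
  apply: bigcup_countable; first exact: countableX.
  by move=> UV _; apply: sub_countable (card_image_le _ _) _; exact: countable_fset.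
apply/quot_leP => x y xy; apply/proj_quotP; apply: contrapT => neq.
have [[P Q] /= [Px Qy] [oP oQ PQ]] : exists2 AB : set (quot E) * set (quot E),
    proj_quot E x \in AB.1 /\ proj_quot E y \in AB.2 &
    [/\ open AB.1, open AB.2 & AB.1 `&` AB.2 == set0].
  by move: hE; rewrite open_hausdorff; apply; apply/eqP.
have base (q : quot E) (P' : set (quot E)) : open P' -> q \in P' ->
    exists2 U, B U & U q /\ closure U `<=` P'.
  move=> oP' /set_mem P'q.
  have [V Vq VP] := regE q P' (open_nbhs_nbhs (conj oP' P'q)).
  have [U [BU Uq] UV] := Bb q V Vq.
  exists U => //; split => //; exact: subset_trans (closureS UV) VP.
have [U BU [Ux UP]] := base _ _ oP Px.
have [V BV [Vy VQ]] := base _ _ oQ Qy.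
have [|p pF] := FP (U, V) _ x y (subset_closure Ux) (subset_closure Vy).
  by move=> q [/UP Pq /VQ Qq]; move/eqP : PQ => <-.
apply; apply: xy; exists (U, V) => //=.
by exists p.
Qed.

Lemma quot_le_agree A B : A `<=` B -> quot_le (agree A : equivalence X) (agree B).
Proof. by move=> AB; apply/quot_leP => x y xy i k /AB; exact: xy. Qed.

Lemma agree_bigcup_sup (T : set (equivalence X)) (a : equivalence X -> set kappa) :
    (forall L, T L -> L = agree (a L)) -> countable (\bigcup_(L in T) a L) ->
  is_sup T (agree (\bigcup_(L in T) a L)).
Proof.
move=> TL cT; split; first exact: Qomega_agree.
- by move=> L LT; rewrite {1}(TL L LT); apply: quot_le_agree; exact: bigcup_sup.
- move=> N _ TN; apply/quot_leP => x y xy i k [L LT aLk].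
  have /quot_leP := TN L LT; rewrite (TL L LT) => /(_ x y xy); exact.
Qed.

(** The set [A0] will carry the norms of the components of the base point. *)
Definition agree_family (A0 : set kappa) : set (equivalence X) :=
  agree @` [set A | [/\ countable A, infinite_set A & A0 `<=` A]].

Lemma agree_family_cofinal A0 : ~ countable [set: kappa] -> countable A0 ->
  cofinal (agree_family A0).
Proof.
move=> uncount cA0 L /countably_determined[A cA LA].
have [N cN iN] : exists2 N : set kappa, countable N & infinite_set N.
  by apply: countable_infinite_subset => /finite_set_countable.
exists (agree (A `|` A0 `|` N)); last first.
  apply/quot_leP => x y xy; move/quot_leP : LA; apply => i k Ak.
  by apply: xy; left; left.
exists (A `|` A0 `|` N) => //; split.
- by apply: countable_setU => //; exact: countable_setU.
- by apply: sub_infinite_set iN => k; right.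
- by move=> k; left; right.
Qed.

Lemma agree_family_sigma A0 : sigma_semilattice (agree_family A0).
Proof.
move=> T TS cT [L0 TL0].
have ex_a (L : equivalence X) : exists A, T L ->
    [/\ countable A, infinite_set A, A0 `<=` A & L = agree A].
  have [/TS[A [cA iA A0A] <-]|nTL] := pselect (T L); last by exists set0.
  by exists A.
pose a L := projT1 (cid (ex_a L)).
have aP L : T L ->
    [/\ countable (a L), infinite_set (a L), A0 `<=` a L & L = agree (a L)].
  exact: projT2 (cid (ex_a L)).
have ca : countable (\bigcup_(L in T) a L).
  by apply: bigcup_countable => // L /aP[].
exists (agree (\bigcup_(L in T) a L)).
  by apply: agree_bigcup_sup => // L /aP[].
have [_ ia A0a _] := aP L0 TL0.
exists (\bigcup_(L in T) a L) => //; split => //.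
- by apply: sub_infinite_set ia; exact: bigcup_sup.
- by apply: subset_trans A0a _; exact: bigcup_sup.
Qed.

End cofinality.

(** * The fiber orders *)

Section fiber_orders.
Variables (R : realType) (kappa : choiceType) (I : finType).
Local Notation l2 := (ell2 R kappa).
Local Notation X := {ptws I -> ell2_ball R kappa}.
Implicit Types (x y z : X) (F : {fset I * kappa}) (A B D : set kappa).

(** A mass is the supremum of finite sums of squares, which are continuous. *)
Lemma mass_lower_semicontinuous B D x i (c : R) : D `<=` B ->
  c < mass D (entry x i) ->
  nbhs (proj_quot (agree B) x) [set r | c < mass D (entry (repr r) i)].
Proof.
move=> DB /mass_approx[F FD cF].
have cv : continuous (fun r : quot (agree B : equivalence X) =>
    \sum_(k <- F | k \in F) entry (repr r) i k ^+ 2 : R).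
  apply: continuous_big => [|k kF r]; first exact: add_continuous.
  have Bk : B k by apply/DB/FD.
  apply: (@continuous_comp _ _ _ _ (fun a : R => a ^+ 2)).
    exact: entry_repr_continuous.
  exact: exprn_continuous.
rewrite big_seq in cF.
have cx := cv (proj_quot (agree B) x).
rewrite -(eq_bigr _ (fun k kF =>
  congr1 (fun a => a ^+ 2) (entry_repr x i (DB k (FD k kF))))) in cF.
apply: filterS (cvgr_gt _ cx _ cF) => r /=; rewrite -big_seq => /lt_le_trans; apply.
exact: fsum_sqr_le_mass.
Qed.

Section natural_projection.
Variables (A B : set kappa) (AB : A `<=` B) (A_infinite : infinite_set A).
Variables (x : X).
Variable q : quot (agree B : equivalence X) -> quot (agree A : equivalence X).
Hypothesis qP : natural_projection q.

Let qE y : q (proj_quot (agree B) y) = proj_quot (agree A) y.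
Proof. by case: qP => _ _ E; rewrite -[LHS]/((q \o proj_quot _) y) E. Qed.

(** Fiber orders are compared on representatives in the power of the ball,
    where masses and boxes make sense; only the coordinates in [B] of the
    representative are meaningful. *)
Definition lift (s : fiber q (proj_quot (agree A) x)) : X := repr (val s).

Lemma lift_agree s i k : A k -> entry (lift s) i k = entry x i k.
Proof.
have sx : q (val s) = proj_quot (agree A) x := set_mem (valP s).
by rewrite -[val s]repr_quotK qE in sx; move/proj_quotP : sx; exact.
Qed.

Lemma mass_split y i :
  mass B (entry y i) = mass A (entry y i) + mass (B `\` A) (entry y i).
Proof. by rewrite (massID A) setIC (setIidl AB). Qed.

(** Suppose that [s] has more mass than [t] on [B \ A] in component i. By lower
    semicontinuity all points near [s] have more mass there than [t], so that
    their squared norm over [A] is less than 1 minus the mass of [t]. Now let [z]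
    be [t] with one coordinate in [A] enlarged until component i has norm 1. If
    that coordinate is outside the finite set seen by a neighborhood of [t],
    the point [z] is in this neighborhood, and its image in the quotient over
    [A] is not the image of a point near [s]. *)
Lemma fiber_le_mass s t : fiber_le s t -> forall i,
  mass (B `\` A) (entry (lift s) i) <= mass (B `\` A) (entry (lift t) i).
Proof.
move=> st i; rewrite leNgt; apply/negP => ts.
have := @mass_lower_semicontinuous B _ _ i _ (@subDsetl _ B A) ts.
rewrite repr_quotK => /st[V].
rewrite -{1}[val t]repr_quotK => /nbhs_quot_box[F [eta eta0 FV]] VU.
have [k [Ak kF]] : exists k, A k /\ (i, k) \notin F.
  apply: contrapT => h; apply: A_infinite.
  apply: (@sub_finite_set _ _ (snd @` [set` F])).
    move=> k Ak; exists (i, k) => //=; apply/negPn/negP => ikF.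
    by apply: h; exists k.
  exact/finite_image/finite_fset.
(* The mass missing from component i of t is put on the coordinate k. *)
pose g : R := 1 - mass B (entry (lift t) i).
have g0 : 0 <= g by rewrite subr_ge0 mass_entry.
have [z zP] : exists z : X, forall j, (forall k', B k' -> (j = i -> k' <> k) ->
    entry z j k' = entry (lift t) j k') /\
    (j = i -> entry z j k ^+ 2 = entry (lift t) i k ^+ 2 + g).
  pose P j (w : l2) := (forall k', B k' -> (j = i -> k' <> k) ->
    w k' = entry (lift t) j k') /\
    (j = i -> w k ^+ 2 = entry (lift t) i k ^+ 2 + g).
  apply: (exists_rows (P := P)) => j; rewrite /P.
  have [->|/eqP ji] := eqVneq j i; last first.
    by exists (entry (lift t) j); [split|exact: mass_entry].
  pose a := Num.sqrt (entry (lift t) i k ^+ 2 + g).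
  have a2 : a ^+ 2 = entry (lift t) i k ^+ 2 + g.
    by rewrite sqr_sqrtr// addr_ge0// sqr_ge0.
  have := @ell2_glue R kappa (B `\` [set k]) [set k] (entry (lift t) i) (fun=> a) _ _ _
    (esum_mass _ _) (esum_set1 _).
  case.
  - by apply/disj_setPS => k' [[_ ?] ?].
  - by rewrite lee_fin sqr_ge0.
  move=> w [wB wk _ wm]; exists w.
    split=> [k' Bk' /(_ erefl) k'k|_]; first by rewrite wB.
    by rewrite wk.
  rewrite wm a2 addrA (addrC (mass _ _)) -mass1.
  have := massID [set k] B (entry (lift t) i).
  rewrite setIC (setIidl _); last by move=> _ ->; exact: AB.
  rewrite /g => ->; lra.
have Vz : V (proj_quot (agree B) z).
  apply: FV => p pF Bp; rewrite (zP p.1).1 ?subrr ?normr0// => p1 p2.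
  by move: kF; rewrite -p1 -p2 -surjective_pairing pF.
have [w Uw] : (q @` [set r | mass (B `\` A) (entry (lift t) i) <
    mass (B `\` A) (entry (repr r) i)]) (q (proj_quot (agree B) z)).
  by apply: VU; exists (proj_quot (agree B) z).
rewrite -{1}[w]repr_quotK !qE => /proj_quotP wz.
have := mass_entry B (repr w) i.
rewrite mass_split (@eq_mass _ _ A _ (entry z i)) => [|k' Ak']; last exact: wz.
have zA : mass A (entry z i) = mass A (entry (lift t) i) + g.
  rewrite (massID [set k] A) [in RHS](massID [set k] A) setIC (setIidl _); last first.
    by move=> _ ->.
  rewrite !mass1 (zP i).2// (@eq_mass _ _ (A `\` [set k]) _ (entry (lift t) i)).
    by rewrite addrAC.
  by move=> k' [Ak' k'k]; apply: (zP i).1 => //; exact: AB.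
rewrite zA /g mass_split; move: Uw => /=; lra.
Qed.

(** Points near [t] have on [B \ A], in each component, at least the mass of
    lam * s, for a fixed lam < 1 close to 1. Replacing their coordinates in
    [B \ A] by those of lam * s keeps them in the ball, does not change their
    image in the quotient over [A], and brings them close to [s]. *)
Lemma mass_fiber_le s t : (forall i,
    mass (B `\` A) (entry (lift s) i) <= mass (B `\` A) (entry (lift t) i)) ->
  fiber_le s t.
Proof.
move=> st U; rewrite -{1}[val s]repr_quotK => /nbhs_quot_box[F [eta eta0 FU]].
pose e := Num.min eta 1; have e0 : 0 < e by rewrite lt_min eta0 ltr01.
have e1 : e <= 1 by rewrite ge_min lexx orbT.
have eeta : e <= eta by rewrite ge_min lexx.
(* Coordinates are bounded by 1, so that those of lam * s are within e / 2 of
   those of s. *)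
pose lam := 1 - e / 2.
have lam0 : 0 < lam by rewrite /lam; lra.
have lam1 : lam ^+ 2 < 1 by rewrite /lam; nra.
pose V := [set r : quot (agree B : equivalence X) |
  (forall p, p \in F -> B p.2 ->
    `|entry (lift t) p.1 p.2 - entry (repr r) p.1 p.2| < eta) /\
  (forall i, lam ^+ 2 * mass (B `\` A) (entry (lift s) i) <=
    mass (B `\` A) (entry (repr r) i))].
exists V.
  rewrite -[val t]repr_quotK; apply: filterI; first exact: quot_box_nbhs.
  apply: (@filter_forall _ I (fun i (r : quot (agree B : equivalence X)) =>
    lam ^+ 2 * mass (B `\` A) (entry (lift s) i) <=
    mass (B `\` A) (entry (repr r) i)) _ (nbhs_filter _)) => i.
  have [->|s0] := eqVneq (mass (B `\` A) (entry (lift s) i)) 0.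
    by apply: filterE => r; rewrite /= mulr0 mass_ge0.
  have lt_st : lam ^+ 2 * mass (B `\` A) (entry (lift s) i) <
      mass (B `\` A) (entry (lift t) i).
    apply: lt_le_trans (st i).
    by rewrite gtr_pMl// lt_neqAle eq_sym s0 mass_ge0.
  have := @mass_lower_semicontinuous B _ _ i _ (@subDsetl _ B A) lt_st.
  by apply: filterS => r; exact: ltW.
move=> _ [r [rt rm] <-].
have [w wP] : exists w : X, forall i,
    (forall k, A k -> entry w i k = entry (repr r) i k) /\
    (forall k, (B `\` A) k -> entry w i k = lam * entry (lift s) i k).
  pose P i (w : l2) := (forall k, A k -> w k = entry (repr r) i k) /\
    (forall k, (B `\` A) k -> w k = lam * entry (lift s) i k).
  apply: (exists_rows (P := P)) => i.
  have := @ell2_glue R kappa A (B `\` A) _ (lam *: entry (lift s) i) _ _ _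
    (esum_mass A (entry (repr r) i)) (esum_mass _ _).
  case; first by apply/disj_setPS => k [Ak []].
  move=> w [wA wB _ wm]; exists w => //; rewrite wm massZ.
  by rewrite (le_trans _ (mass_entry B (repr r) i))// mass_split lerD2l.
exists (proj_quot (agree B) w); last first.
  rewrite -[r in RHS]repr_quotK !qE; apply/proj_quotP => i k.
  exact: (wP i).1.
apply: FU => p pF Bp; have [Ap|nAp] := pselect (A p.2).
  have := rt p pF Bp; rewrite (wP p.1).1//.
  by rewrite -[repr (val s)]/(lift s) !lift_agree.
rewrite (wP p.1).2// -[repr (val s)]/(lift s).
set a := entry _ _ _; have a1 : `|a| <= 1.
  rewrite -(@expr_le1 _ 2)// real_normK ?num_real// -[leLHS]mass1.
  exact: mass_entry.
have -> : a - lam * a = (e / 2) * a by rewrite /lam; ring.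
rewrite normrM gtr0_norm ?divr_gt0//; nra.
Qed.

(** The isomorphism sends the class of [s] to the masses of [s] on [B \ A],
    each divided by the room 1 - ||x_i||^2 left by the base point, for the
    components where this room is positive; elsewhere the mass is zero. *)
Lemma fiber_order_cube :
    (forall i, mass A (entry x i) = mass setT (entry x i)) -> (B `\` A) !=set0 ->
  order_isomorphic (fiber_order q (proj_quot (agree A) x))
    ('I_#|[pred i : I | hnorm (x i) < 1]| -> {i01 R}).
Proof.
move=> xA [k0 [Bk0 nAk0]].
pose J := [pred i : I | hnorm (x i) < 1].
pose room i := 1 - mass A (entry x i).
have roomJ i : (0 < room i) = (i \in J).
  by rewrite /room xA subr_gt0 mass_norm inE /hnorm expr_lt1.
have mass_room s i : mass (B `\` A) (entry (lift s) i) <= room i.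
  have := mass_entry B (lift s) i; rewrite mass_split.
  rewrite (@eq_mass _ _ A _ (entry x i)) => [|k]; last exact: lift_agree.
  by rewrite /room; lra.
pose f (a : fiber_order q (proj_quot (agree A) x)) (j : 'I_#|J|) : R :=
  mass (B `\` A) (entry (lift (repr a)) (enum_val j)) / room (enum_val j).
have room_gt0 (j : 'I_#|J|) : 0 < room (enum_val j) by rewrite roomJ enum_valP.
have f0 a j : 0 <= f a j by rewrite divr_ge0 ?mass_ge0 ?ltW.
have f1 a j : f a j <= 1 by rewrite ler_pdivrMr// mul1r.
pose phi a : 'I_#|J| -> {i01 R} := fun j => Itv01 (f0 a j) (f1 a j).
have phi_mono : {mono phi : a b / (a <= b)%O}.
  move=> a b; rewrite -[a in RHS]reprK -[b in RHS]reprK.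
  apply/idP/idP => [/lefP ab|].
    apply/fiber_order_leE/mass_fiber_le => i.
    have [iJ|] := boolP (i \in J).
      have := ab (enum_rank_in iJ i).
      rewrite -num_le/= /f enum_rankK_in//.
      by rewrite ler_pM2r// invr_gt0 roomJ.
    rewrite -roomJ -leNgt => ri; apply: le_trans (mass_ge0 _ _).
    exact: le_trans (mass_room _ _) ri.
  move/fiber_order_leE/fiber_le_mass => ab; apply/lefP => j.
  by rewrite -num_le/= /f ler_pM2r ?invr_gt0.
have phi_inj : injective phi.
  move=> a b ab; apply: le_anti.
  by rewrite -!phi_mono ab lexx.
have phi_surj (u : 'I_#|J| -> {i01 R}) : exists a, phi a = u.
  have [z zP] : exists z : X, forall i,
     (forall k, A k -> entry z i k = entry x i k) /\
     forall j : 'I_#|J|, i = enum_val j ->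
       mass (B `\` A) (entry z i) = (u j)%:num * room i.
    pose P i (w : l2) := (forall k, A k -> w k = entry x i k) /\
      forall j : 'I_#|J|, i = enum_val j ->
        mass (B `\` A) w = (u j)%:num * room i.
    apply: (exists_rows (P := P)) => i; rewrite /P.
    (* The value c prescribed at i, or 0 when component i has norm 1. *)
    have [c [c0 c1 cu]] : exists c : R, [/\ 0 <= c, c <= 1 &
        forall j : 'I_#|J|, i = enum_val j -> (u j)%:num = c].
      have [iJ|iJ] := boolP (i \in J).
        exists (u (enum_rank_in iJ i))%:num; split => // j ij.
        by congr (u _)%:num; apply: enum_val_inj; rewrite enum_rankK_in.
      by exists 0; split => // j ij; move: iJ; rewrite ij enum_valP.
    have r0 : 0 <= room i by rewrite subr_ge0 mass_entry.
    pose a := Num.sqrt (c * room i).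
    have a2 : a ^+ 2 = c * room i by rewrite sqr_sqrtr// mulr_ge0.
    have := @ell2_glue R kappa A [set k0] (entry x i) (fun=> a) _ _ _
      (esum_mass _ _) (esum_set1 _).
    case.
    - by apply/disj_setPS => k [/[swap] ->].
    - by rewrite lee_fin sqr_ge0.
    move=> w [wA wk _ wm]; rewrite a2 in wm; exists w.
      split=> // j /cu ->; apply: le_anti; apply/andP; split; last first.
        rewrite -a2 -(wk k0)// -mass1; apply: le_mass => k ->.
        by split.
      have := le_mass w (@subsetT _ B); rewrite wm (massID A B) setIC (setIidl AB).
      by rewrite (eq_mass wA) lerD2l.
    by rewrite wm /room; have := mass_entry A x i; rewrite /room in r0; nra.
  have zx : (q @^-1` [set proj_quot (agree A) x]) (proj_quot (agree B) z).
    by rewrite /= qE; apply/proj_quotP => i k; exact: (zP i).1.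
  pose s : fiber q (proj_quot (agree A) x) :=
    exist _ (proj_quot (agree B) z) (mem_set zx).
  have sz i k : B k -> entry (lift s) i k = entry z i k by exact: entry_repr.
  pose a : fiber_order q (proj_quot (agree A) x) :=
    \pi_(fiber_order q (proj_quot (agree A) x)) s.
  exists a; apply/funext => j; apply/val_inj; change (f a j = (u j)%:num); rewrite /f.
  have [le1 le2] := fiber_repr_pi s.
  rewrite (_ : mass _ _ =
    mass (B `\` A) (entry (lift s) (enum_val j))); last first.
    by apply: le_anti; rewrite !fiber_le_mass.
  rewrite (@eq_mass _ _ _ _ (entry z (enum_val j))) => [|k [Bk _]]; last exact: sz.
  by rewrite ((zP (enum_val j)).2 j erefl) mulfK ?gt_eqF.
exists phi => //.
pose g u := projT1 (cid (phi_surj u)).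
have gK u : phi (g u) = u := projT2 (cid (phi_surj u)).
by exists g => // a; apply: phi_inj; rewrite gK.
Qed.

End natural_projection.
End fiber_orders.

(** * Order type of a point *)

(** Finite sums of squares approach the squared norm up to 1 / (m + 1), for each
    m; the union of the finite sets of indices carries the whole norm. *)
Lemma mass_countable_carrier (R : realType) (kappa : choiceType)
    (w : ell2 R kappa) :
  exists2 N : set kappa, countable N &
    forall A, N `<=` A -> mass A w = mass setT w.
Proof.
have ex_F (m : nat) : exists F : {fset kappa},
    mass setT w - m.+1%:R^-1 < \sum_(k <- F) w k ^+ 2.
  have [|F _ Fm] := @mass_approx _ _ setT w (mass setT w - m.+1%:R^-1).
    by rewrite ltrBlDr ltrDl invr_gt0.
  by exists F.
pose F m := projT1 (cid (ex_F m)).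
have FP m : mass setT w - m.+1%:R^-1 < \sum_(k <- F m) w k ^+ 2 :=
  projT2 (cid (ex_F m)).
exists (\bigcup_m [set` F m]).
  by apply: bigcup_countable => // m _; exact: countable_fset.
move=> A NA; apply: le_anti; rewrite (le_mass w (@subsetT _ A))/=.
apply/ler_addgt0Pr => e e0; rewrite -lerBlDr.
have [m _ /(_ m (leqnn m)) me] := near_infty_natSinv_lt (PosNum e0).
apply: le_trans (le_trans _ (ltW (FP m))) _.
  by rewrite lerD2l lerN2 ltW.
by apply: fsum_sqr_le_mass => k Fk; apply: NA; exists m.
Qed.

(** A unit vector at a coordinate of [A] outside [B] is identified with zero
    over [B], but not over [A]. *)
Lemma quot_le_agree_subset (R : realType) (kappa : choiceType) (I : finType)
    (i : I) (A B : set kappa) :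
  quot_le (agree A : equivalence {ptws I -> ell2_ball R kappa}) (agree B) ->
  A `<=` B.
Proof.
move=> /quot_leP AB k Ak; apply: contrapT => nBk.
have [e eP] : exists e : {ptws I -> ell2_ball R kappa}, forall j,
    entry e j k = 1 /\ forall k', k' <> k -> entry e j k' = 0.
  apply: (exists_rows (P := fun _ w =>
    w k = 1 /\ forall k', k' <> k -> w k' = 0)).
  move=> j; have := @ell2_glue R kappa [set k] set0 (fun=> 1) (fun=> 0) _ 0 _
    (esum_set1 _) (esum_set0 _).
  case; [by apply/disj_setPS; rewrite setI0|by rewrite lee_fin sqr_ge0|].
  move=> w [wk _ w0 wm]; exists w; last by rewrite wm; lra.
  by split => [|k' kk']; [exact: wk|exact: w0].
have [z zP] : exists z : {ptws I -> ell2_ball R kappa}, forall j, entry z j = 0.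
  apply: (exists_rows (P := fun _ w => w = 0)) => j; exists 0 => //.
  by rewrite mass_norm normr0 expr0n.
(* Here e has a 1 at k in every component, and z is the origin. *)
have ez : equivalence_graph (agree B) e z.
  move=> j k' Bk'; rewrite zP (eP j).2// => kk'.
  by apply: nBk; rewrite -kk'.
have := AB _ _ ez i k Ak; rewrite zP (eP i).1 => /eqP.
by rewrite -[X in _ == X]/(0 : R) oner_eq0.
Qed.

Theorem theorem1p2 (R : realType) (kappa : choiceType)
    (kappa_uncountable : ~ countable [set: kappa])
    (n : nat) (n_ge1 : (1 <= n)%N)
    (x : {ptws 'I_n -> ell2_ball R kappa}) :
  let r := #|[pred i : 'I_n | hnorm (x i) < 1]| in
  has_order x ('I_r -> {i01 R}).
Proof.
move=> r; pose N i := projT1 (cid2 (mass_countable_carrier (entry x i))).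
pose A0 := \bigcup_i N i.
have cA0 : countable A0.
  apply: bigcup_countable => // i _; rewrite /N; by case: cid2.
have A0x A i : A0 `<=` A -> mass A (entry x i) = mass setT (entry x i).
  move=> A0A; have : N i `<=` A by apply: subset_trans A0A; exact: bigcup_sup.
  by rewrite /N; case: cid2 => M _ MP /=; exact: MP.
exists (agree_family A0); split.
- by move=> _ [A [cA _ _] <-]; exact: Qomega_agree.
- exact: agree_family_cofinal.
- exact: agree_family_sigma.
move=> _ _ [A [_ iA A0A] <-] [B [_ _ _] <-] [AB neq] q qP.
have {}AB : A `<=` B := quot_le_agree_subset (Ordinal n_ge1) AB.
apply: (fiber_order_cube AB iA qP) => [i|]; first exact: A0x.
apply/set0P/negP => /eqP BA0; apply: neq; congr agree.
apply/seteqP; split=> // k Bk; apply: contrapT => nAk.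
by rewrite -[False]/(set0 k) -BA0.
Qed.
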